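(* Let $0<a<b$, and for $0<p<1$ and $u\in[a,b]$ let $$R_p(u)=\left(\frac{u-a}{u}\right)^p\left(\frac{b-u}{u}\right)^{1-p}.$$ For every $0<p<1$, $$\max_{u\in[a,b]}R_p(u)=(b-a)\frac{p^p(1-p)^{1-p}}{b^p a^{1-p}}.$$ The unique minimizer over $p\in(0,1)$ of this worst one-step factor $\max_{u\in[a,b]}R_p(u)$ is $$p_*=\frac{b}{a+b},\qquad 1-p_*=\frac{a}{a+b},$$ and $$\min_{0<p<1}\max_{u\in[a,b]}R_p(u)=\frac{b-a}{b+a}.$$ Thus, when $a<b$ are the endpoints of the active spectrum, the function $\overline f(x)=\|P_ag(x)\|^{\frac{2b}{a+b}}\|P_bg(x)\|^{\frac{2a}{a+b}}$ is the unique minimax member of the family $V_p(x)=\|P_ag(x)\|^{2p}\|P_bg(x)\|^{2(1-p)}$, $0<p<1$; that is, $\overline f=V_{p_*}$, and $p_*$ is the unique $p\in(0,1)$ minimizing $\max_{u\in[a,b]}R_p(u)$.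
   Context: $H\in\mathbb{R}^{d\times d}$ is symmetric positive definite, $q\in\mathbb{R}^d$, $f(x)=\frac12x^{\mathsf T}Hx-q^{\mathsf T}x$, and $g(x)=\nabla f(x)$. In the last sentence of the claim, $a<b$ are two eigenvalues of $H$ (the smallest and largest elements of the active spectrum $\Lambda=\{\lambda\in\operatorname{spec}(H):P_\lambda g_{-1}\ne0\}$ of an initial gradient $g_{-1}$, with $|\Lambda|\ge2$), and $P_\lambda$ denotes the orthogonal projector onto the $\lambda$-eigenspace of $H$. $\|\cdot\|$ is the Euclidean norm. $R_p(u)$ is the square root of the factor by which $V_p$ is multiplied under a gradient step $x\mapsto x-u^{-1}g(x)$ with reciprocal step $u\in[a,b]$; a member $V_p$ is called minimax if $p$ minimizes the worst one-step factor $\max_{u\in[a,b]}R_p(u)$ over $(0,1)$. *)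

(* Defs.v *)
From HB Require Import structures.
From mathcomp Require Import all_boot all_order all_algebra sesquilinear.
From mathcomp Require Import all_classical all_reals all_analysis.

Set Implicit Arguments.
Unset Strict Implicit.
Unset Printing Implicit Defensive.

Import Order.TTheory GRing.Theory Num.Theory.
Import numFieldNormedType.Exports.

Local Open Scope classical_set_scope.
Local Open Scope ring_scope.

Definition is_max (R : realType) (A : set R) (m : R) : Prop :=
  A m /\ ubound A m.

Definition is_min (R : realType) (A : set R) (m : R) : Prop :=
  A m /\ lbound A m.

(* R_p(u); both bases are nonnegative for u in [a, b], where powR is the usual
   real power (with value 0 at base 0, since p and 1 - p are nonzero). *)
Definition step_factor (R : realType) (a b p u : R) : R :=
  ((u - a) / u) `^ p * ((b - u) / u) `^ (1 - p).

Definition step_factors (R : realType) (a b p : R) : set R :=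
  [set step_factor a b p u | u in `[a, b]%classic].

(* max_{u in [a, b]} R_p(u), as a total function of p: sup has a junk value on
   sets without a supremum, so attainment has to be asserted with is_max. *)
Definition worst_factor (R : realType) (a b p : R) : R :=
  sup (step_factors a b p).

Definition minimax_exponent (R : realType) (a b p : R) : Prop :=
  0 < p < 1 /\
  forall p', 0 < p' < 1 -> worst_factor a b p <= worst_factor a b p'.

Definition posdefmx (R : realType) (d : nat) (H : 'M[R]_d) : Prop :=
  forall x : 'cV[R]_d, x != 0 -> 0 < (x^T *m H *m x) 0 0.

Definition quadratic (R : realType) (d : nat) (H : 'M[R]_d) (q x : 'cV[R]_d)
    : R :=
  2^-1 * (x^T *m H *m x) 0 0 - (q^T *m x) 0 0.

Definition gradient (R : realType) (d : nat) (f : 'cV[R]_d -> R)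
    (x : 'cV[R]_d) : 'cV[R]_d :=
  \col_i 'D_(delta_mx i 0) f x.

(* The library norm on matrices is the sup norm. *)
Definition enorm (R : realType) (d : nat) (x : 'cV[R]_d) : R :=
  Num.sqrt (\sum_i x i 0 ^+ 2).

(* P_l, acting on columns by P_l *m x.  The library eigenspaces consist of row
   vectors: the row space of E is the transpose of {x | H *m x = l *: x}, and
   that of kermx E^T is its Euclidean orthogonal complement. *)
Definition eigenproj (R : realType) (d : nat) (H : 'M[R]_d) (l : R) : 'M[R]_d :=
  let E := eigenspace H^T l in (proj_mx E (kermx E^T))^T.

Definition active_spectrum (R : realType) (d : nat) (H : 'M[R]_d)
    (g0 : 'cV[R]_d) : set R :=
  [set l | eigenvalue H l /\ eigenproj H l *m g0 != 0].

Definition lyapunov (R : realType) (d : nat) (H : 'M[R]_d) (q : 'cV[R]_d)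
    (a b p : R) (x : 'cV[R]_d) : R :=
  let g := gradient (quadratic H q) x in
  enorm (eigenproj H a *m g) `^ (2 * p) *
  enorm (eigenproj H b *m g) `^ (2 * (1 - p)).

Definition fbar (R : realType) (d : nat) (H : 'M[R]_d) (q : 'cV[R]_d)
    (a b : R) (x : 'cV[R]_d) : R :=
  let g := gradient (quadratic H q) x in
  enorm (eigenproj H a *m g) `^ (2 * b / (a + b)) *
  enorm (eigenproj H b *m g) `^ (2 * a / (a + b)).

Definition gradient_step (R : realType) (d : nat) (H : 'M[R]_d) (q : 'cV[R]_d)
    (u : R) (x : 'cV[R]_d) : 'cV[R]_d :=
  x - u^-1 *: gradient (quadratic H q) x.

Definition minimax_member (R : realType) (d : nat) (H : 'M[R]_d)
    (q : 'cV[R]_d) (a b : R) (V : 'cV[R]_d -> R) : Prop :=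
  exists p, minimax_exponent a b p /\ V = lyapunov H q a b p.

(* Main.v *)
(* With X = b (u - a) / (p u) and Y = a (b - u) / ((1 - p) u), the weighted
   mean p X + (1 - p) Y equals b - a for every u, and R_p(u) is a constant
   multiple of X^p Y^(1-p); so the maximum over u comes from weighted AM-GM and
   is attained where X = Y.  At the midpoint u = (a + b) / 2 both bases of R_p
   equal (b - a) / (b + a), so every worst factor is at least this value, and
   the equality case of AM-GM at the midpoint (X = Y there) forces
   p = b / (a + b).  For the descent property, P_l H = l P_l, hence a gradient
   step multiplies P_l g by 1 - l / u. *)

Require Import Defs.
From mathcomp Require Import all_boot all_order all_algebra sesquilinear.
From mathcomp Require Import all_classical all_reals all_analysis.
From mathcomp Require Import ring lra.
Import Order.TTheory GRing.Theory Num.Theory.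
Import numFieldNormedType.Exports.
Local Open Scope classical_set_scope.
Local Open Scope ring_scope.

(** * Weighted AM-GM with its strict case *)

Lemma powR_mul_compl {R : realType} (p x : R) :
  0 <= x -> x `^ p * x `^ (1 - p) = x.
Proof.
move=> x0; rewrite -powRD ?subrKC ?powRr1//.
by rewrite oner_eq0.
Qed.

(** Strict convexity of exp: its tangent at s, the weighted mean of the logarithms, lies strictly
    below exp at [ln x] and [ln y]. In the weighted sum the slopes cancel because p (t1 - s) + (1 -
    p) (t2 - s) = 0, which leaves [expR s]. *)
Lemma lt_weighted_amgm {R : realType} (p x y : R) :
  0 < p < 1 -> 0 < x -> 0 < y -> x != y ->
  x `^ p * y `^ (1 - p) < p * x + (1 - p) * y.
Proof.
move=> /andP[p0 p1] x0 y0 xy.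
pose t1 := ln x; pose t2 := ln y.
have t12 : t1 != t2 by rewrite (inj_in_eq (@ln_inj R)).
pose s := p * t1 + (1 - p) * t2.
have tangent t : t != s -> expR s * (1 + (t - s)) < expR t.
  move=> ts; have -> : expR t = expR s * expR (t - s) by rewrite -expRD subrKC.
  rewrite ltr_pM2l ?expR_gt0//.
  by apply: expR_gt1Dx; rewrite subr_eq0.
have s1 : t1 != s.
  apply: contra t12 => /eqP e; apply/eqP.
  apply: (@mulfI _ (1 - p)); first by lra.
  by rewrite /s in e; lra.
have s2 : t2 != s.
  apply: contra t12 => /eqP e; apply/eqP; apply: (@mulfI _ p); first by lra.
  by rewrite /s in e; lra.
have -> : x `^ p * y `^ (1 - p) = expR s.
  by rewrite /powR !gt_eqF// -expRD.
rewrite -(lnK x0) -(lnK y0) -/t1 -/t2.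
have q0 : 0 < 1 - p by lra.
have lt1 : p * (expR s * (1 + (t1 - s))) < p * expR t1.
  by rewrite ltr_pM2l ?tangent.
have lt2 : (1 - p) * (expR s * (1 + (t2 - s))) < (1 - p) * expR t2.
  by rewrite ltr_pM2l ?tangent.
apply: le_lt_trans (ltrD lt1 lt2).
by rewrite le_eqVlt; apply/orP; left; apply/eqP; rewrite /s; ring.
Qed.

Lemma le_weighted_amgm {R : realType} (p x y : R) :
  0 < p < 1 -> 0 <= x -> 0 <= y -> x `^ p * y `^ (1 - p) <= p * x + (1 - p) * y.
Proof.
move=> p01; have /andP[p0 p1] := p01; have q0 : 0 < 1 - p by lra.
rewrite le_eqVlt => /predU1P[<-|x0] y0.
  (* A zero base makes the left side vanish because its exponent is nonzero. *)
  by rewrite powR0 ?gt_eqF// mul0r mulr0 add0r mulr_ge0// ltW.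
move: y0; rewrite le_eqVlt => /predU1P[<-|y0].
  by rewrite powR0 ?gt_eqF// !mulr0 addr0 mulr_ge0// ltW.
have [->|xy] := eqVneq x y; first by rewrite (powR_mul_compl p _ (ltW y0)); lra.
exact/ltW/lt_weighted_amgm.
Qed.

Lemma is_max_sup {R : realType} (A : set R) (m : R) : is_max A m -> sup A = m.
Proof.
move=> [Am um]; apply/eqP; rewrite eq_le; apply/andP; split.
  by apply: ge_sup => //; exists m.
by apply: ub_le_sup => //; exists m.
Qed.

(** * The worst one-step factor and its minimizer *)

Section worst_factor.
Context {R : realType} (a b : R) (a0b : 0 < a < b).

(** These are the X and Y to which AM-GM applies; [coef] is the constant in front of X^p Y^(1-p). *)
Let wleft (p u : R) := b * (u - a) / (p * u).
Let wright (p u : R) := a * (b - u) / ((1 - p) * u).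
Let coef (p : R) := p `^ p * (1 - p) `^ (1 - p) / (b `^ p * a `^ (1 - p)).

Let wleft_ge0 p u : 0 < p < 1 -> a <= u <= b -> 0 <= wleft p u.
Proof.
have /andP[a0 ab] := a0b.
move=> /andP[p0 p1] /andP[au ub].
by rewrite divr_ge0 ?mulr_ge0//; lra.
Qed.

Let wright_ge0 p u : 0 < p < 1 -> a <= u <= b -> 0 <= wright p u.
Proof.
have /andP[a0 ab] := a0b.
move=> /andP[p0 p1] /andP[au ub].
by rewrite divr_ge0 ?mulr_ge0//; lra.
Qed.

Let weighted_sum p u : 0 < p < 1 -> a <= u <= b ->
  p * wleft p u + (1 - p) * wright p u = b - a.
Proof.
have /andP[a0 ab] := a0b.
move=> /andP[p0 p1] /andP[au ub].
by rewrite /wleft /wright; field; apply/and3P; split; lra.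
Qed.

Let coef_gt0 p : 0 < p < 1 -> 0 < coef p.
Proof.
have /andP[a0 ab] := a0b; have b0 := lt_trans a0 ab.
move=> /andP[p0 p1].
by rewrite /coef divr_gt0 ?mulr_gt0 ?powR_gt0// subr_gt0.
Qed.

Lemma step_factorE p u : 0 < p < 1 -> a <= u <= b ->
  step_factor a b p u = coef p * (wleft p u `^ p * wright p u `^ (1 - p)).
Proof.
have /andP[a0 ab] := a0b; have b0 := lt_trans a0 ab.
move=> p01 uab; have wl := wleft_ge0 _ _ p01 uab.
have wr := wright_ge0 _ _ p01 uab.
have /andP[p0 p1] := p01; have /andP[au ub] := uab.
have q0 : 0 < 1 - p by lra.
rewrite /step_factor.
have -> : (u - a) / u = p / b * wleft p u.
  by rewrite /wleft; field; apply/and3P; split; lra.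
have -> : (b - u) / u = (1 - p) / a * wright p u.
  by rewrite /wright; field; apply/and3P; split; lra.
have powRV (x r : R) : 0 < x -> x^-1 `^ r = (x `^ r)^-1.
  by move=> x0; rewrite -(powR_inv1 (ltW x0)) -powRrM mulN1r powRN.
rewrite 2?(@powRM _ (_ / _)) ?(@powRM _ p) ?(@powRM _ (1 - p)) ?powRV//;
  rewrite ?divr_ge0 ?invr_ge0 ?ltW//.
by rewrite /coef invfM; ring.
Qed.

Let mid := (a + b) / 2.
Let mid_ab : a <= mid <= b.
Proof.
have /andP[a0 ab] := a0b.
by rewrite /mid; lra.
Qed.

Lemma step_factor_midpoint p :
  step_factor a b p mid = (b - a) / (b + a).
Proof.
have /andP[a0 ab] := a0b.
have mid0 : 0 < mid by rewrite /mid; lra.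
rewrite /step_factor.
have -> : (b - mid) / mid = (mid - a) / mid by rewrite /mid; congr (_ / _); lra.
rewrite powR_mul_compl; last by rewrite divr_ge0 /mid; lra.
by rewrite /mid; field; lra.
Qed.

Lemma is_max_step_factors p : 0 < p < 1 ->
  is_max (step_factors a b p) ((b - a) * coef p).
Proof.
have /andP[a0 ab] := a0b; have b0 := lt_trans a0 ab.
move=> p01; have /andP[p0 p1] := p01.
have q0 : 0 < 1 - p by lra.
have cp := coef_gt0 _ p01.
split=> [|_ [u uab <-]]; last first.
  have {}uab : a <= u <= b by move: uab; rewrite /= in_itv.
  rewrite step_factorE// mulrC ler_pM2r// -(weighted_sum _ _ p01 uab).
  by apply: le_weighted_amgm; rewrite ?wleft_ge0 ?wright_ge0.
(* The equation X = Y reads (1 - p) b (u - a) = p a (b - u), whose solution is u = a b / D. *)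
pose D := (1 - p) * b + p * a.
have D0 : 0 < D by rewrite addr_gt0 ?mulr_gt0.
pose u := a * b / D.
have u0 : 0 < u by rewrite divr_gt0 ?mulr_gt0.
have uab : a <= u <= b.
  rewrite ler_pdivlMr// ler_pdivrMr// ler_pM2l// (mulrC a b) ler_pM2l//.
  (* What remains is a <= D <= b, where b - D = p (b - a) and D - a = (1 - p) (b - a). *)
  have pba : 0 < p * (b - a) by rewrite mulr_gt0 ?subr_gt0.
  have qba : 0 < (1 - p) * (b - a) by rewrite mulr_gt0 ?subr_gt0.
  by rewrite /D; apply/andP; split; lra.
exists u; first by rewrite /= in_itv.
have wE : wleft p u = b - a /\ wright p u = b - a.
  move: D0; rewrite /wleft /wright /u /D => D0.
  by split; field; rewrite !gt_eqF//; lra.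
rewrite step_factorE// !(proj1 wE) !(proj2 wE) powR_mul_compl ?subr_ge0 ?ltW//.
by rewrite mulrC.
Qed.

Lemma worst_factorE p : 0 < p < 1 -> worst_factor a b p = (b - a) * coef p.
Proof. by move=> p01; apply: is_max_sup; exact: is_max_step_factors. Qed.

Let pstar := b / (a + b).

Lemma pstar_bounds : 0 < pstar < 1.
Proof.
have /andP[a0 ab] := a0b; have b0 := lt_trans a0 ab.
by rewrite divr_gt0 ?addr_gt0//= ltr_pdivrMr ?addr_gt0// mul1r ltrDr.
Qed.

(** At this exponent the midpoint is itself the maximizer, since X = Y = b - a there. *)
Lemma worst_factor_pstar : worst_factor a b pstar = (b - a) / (b + a).
Proof.
have /andP[a0 ab] := a0b.
have p01 := pstar_bounds.
rewrite worst_factorE// -(step_factor_midpoint pstar) step_factorE// mulrC.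
have -> : wleft pstar mid = b - a.
  by rewrite /wleft /mid /pstar; field; rewrite -?andbA;
    do ?[apply/andP; split]; lra.
have -> : wright pstar mid = b - a.
  by rewrite /wright /mid /pstar; field; rewrite -?andbA;
    do ?[apply/andP; split]; lra.
by rewrite powR_mul_compl// subr_ge0 ltW.
Qed.

Lemma worst_factor_gt p : 0 < p < 1 -> p != pstar ->
  (b - a) / (b + a) < worst_factor a b p.
Proof.
have /andP[a0 ab] := a0b; have b0 := lt_trans a0 ab.
move=> p01 pp; have /andP[p0 p1] := p01.
have q0 : 0 < 1 - p by lra.
rewrite worst_factorE// -(step_factor_midpoint p) step_factorE// mulrC.
rewrite ltr_pM2r ?coef_gt0// -(weighted_sum _ _ p01 mid_ab).
have m0 : 0 < mid by rewrite /mid; lra.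
have d1 : 0 < mid - a by rewrite /mid; lra.
have d2 : 0 < b - mid by rewrite /mid; lra.
apply: lt_weighted_amgm => //.
- by apply: divr_gt0; apply: mulr_gt0.
- by apply: divr_gt0; apply: mulr_gt0.
(* If X = Y at the midpoint, clearing denominators and cancelling mid - a = b - mid leaves b (1 - p)
   = a p, that is p = b / (a + b). *)
apply: contra pp => /eqP e; apply/eqP.
have : wleft p mid * (p * (1 - p) * mid) = wright p mid * (p * (1 - p) * mid).
  by rewrite e.
have -> : wleft p mid * (p * (1 - p) * mid) = b * (1 - p) * (mid - a).
  by rewrite /wleft; field; rewrite !gt_eqF.
have -> : wright p mid * (p * (1 - p) * mid) = a * p * (mid - a).
  have -> : mid - a = b - mid by rewrite /mid; lra.
  by rewrite /wright; field; rewrite !gt_eqF.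
move/(mulIf (lt0r_neq0 d1)) => e2.
have s0 : a + b != 0 by rewrite gt_eqF ?addr_gt0.
by rewrite /pstar; apply: (mulIf s0); rewrite divfK//; lra.
Qed.

Lemma worst_factor_ge p : 0 < p < 1 -> (b - a) / (b + a) <= worst_factor a b p.
Proof.
move=> p01; have [->|pp] := eqVneq p pstar; first by rewrite worst_factor_pstar.
exact/ltW/worst_factor_gt.
Qed.

Lemma unique_minimax_exponent : unique (minimax_exponent a b) pstar.
Proof.
split; first split; first exact: pstar_bounds.
- by move=> p p01; rewrite worst_factor_pstar; exact: worst_factor_ge.
- move=> p [p01 pmin]; apply/eqP; rewrite eq_sym; apply/negP => /negP pp.
  have := worst_factor_gt _ p01 pp; rewrite -worst_factor_pstar.
  by apply/negP; rewrite -leNgt; apply: pmin; exact: pstar_bounds.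
Qed.

End worst_factor.

(** * The gradient of the quadratic *)

Lemma symmetricmx_tr {R : realType} (d : nat) (H : 'M[R]_d) :
  H \is symmetricmx -> H^T = H.
Proof.
(* [symmetricmx] unfolds to a signed transpose mapped entrywise by the identity; the sign is
   (-1)^0. *)
move=> /eqP; rewrite expr0 scale1r => e; rewrite {2}e.
by apply/matrixP => i j; rewrite !mxE.
Qed.

(** Exact second-order expansion. The argument [h *: v + x] matches the definition of the
    directional derivative, and the factor h is pulled out so that the difference quotient becomes
    affine in h. *)
Lemma quadratic_shift {R : realType} (d : nat) (H : 'M[R]_d) (q x v : 'cV[R]_d)
    (h : R) : H^T = H ->
  quadratic H q (h *: v + x) - quadratic H q x =
  h * ((v^T *m (H *m x - q)) 0 0 + h * (2^-1 * (v^T *m H *m v) 0 0)).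
Proof.
move=> Hs.
have tr00 (M : 'M[R]_1) : M 0 0 = M^T 0 0 by rewrite mxE.
have xv : (x^T *m H *m v) 0 0 = (v^T *m H *m x) 0 0.
  by rewrite tr00 !trmx_mul trmxK Hs mulmxA.
have qv : (q^T *m v) 0 0 = (v^T *m q) 0 0 by rewrite tr00 trmx_mul trmxK.
have tr_shift : (h *: v + x)^T = h *: v^T + x^T by rewrite linearD linearZ.
rewrite /quadratic tr_shift !mulmxDl !mulmxDr mulmxA mulmxN.
rewrite -!scalemxAl -!scalemxAr.
have D00 (M N : 'M[R]_1) : (M + N) 0 0 = M 0 0 + N 0 0 by rewrite mxE.
have Z00 (c : R) (M : 'M[R]_1) : (c *: M) 0 0 = c * M 0 0 by rewrite mxE.
have N00 (M : 'M[R]_1) : (- M) 0 0 = - M 0 0 by rewrite mxE.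
by rewrite !(D00, Z00, N00) xv qv; field.
Qed.

Lemma lim_affine_slope {R : realType} (f : R -> R) (c k : R) :
  (forall h, f h = h * (c + h * k)) -> lim ((fun h => h^-1 *: f h) @ 0^') = c.
Proof.
move=> fE; apply/cvg_lim => //.
have -> : nbhs c = nbhs (c + 0 * k) by rewrite mul0r addr0.
apply: (@cvg_trans _ ((fun h => c + h * k) @ 0^')).
  (* The quotient equals c + h k only for h != 0, which is enough on the punctured filter. *)
  apply: near_eq_cvg; near=> h.
  rewrite fE /GRing.scale/= mulKf//.
  by near: h; exact: nbhs_dnbhs_neq.
apply: cvgD; first exact: cvg_cst.
apply: cvgM; last exact: cvg_cst.
exact: nbhs_dnbhs.
Unshelve. all: by end_near. Qed.

Lemma gradient_quadratic {R : realType} (d : nat) (H : 'M[R]_d)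
    (q x : 'cV[R]_d) : H^T = H -> gradient (quadratic H q) x = H *m x - q.
Proof.
move=> Hs; apply/colP => i; rewrite [LHS]mxE /derive.
rewrite (lim_affine_slope _ _ _ (fun h => quadratic_shift _ _ q x _ h Hs)).
by rewrite trmx_delta -rowE mxE.
Qed.

(** * Orthogonal eigenprojectors of a symmetric matrix *)

Lemma mulmx_tr_eq0 {R : realType} (m n : nat) (W : 'M[R]_(m, n)) :
  W *m W^T = 0 -> W = 0.
Proof.
move=> W0; apply/matrixP => i j; rewrite mxE.
(* Each diagonal entry of W W^T is the sum of squares of a row of W. *)
have : (W *m W^T) i i = 0 by rewrite W0 mxE.
rewrite mxE => /eqP; rewrite psumr_eq0; last first.
  by move=> k _; rewrite mxE -expr2 sqr_ge0.
by move/allP/(_ j (mem_index_enum _)); rewrite mxE -expr2 sqrf_eq0 => /eqP.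
Qed.

(** A matrix W with rows in both spaces has the form D E and satisfies W E^T = 0, so W W^T = W E^T
    D^T = 0. *)
Lemma cap_kermx_tr {R : realType} (d : nat) (E : 'M[R]_d) :
  (E :&: kermx E^T = 0)%MS.
Proof.
apply: mulmx_tr_eq0; set W := (E :&: _)%MS.
have /submxP[D DE] : (W <= E)%MS by exact: capmxSl.
have /sub_kermxP WK : (W <= kermx E^T)%MS by exact: capmxSr.
by rewrite {2}DE trmx_mul mulmxA WK mul0mx.
Qed.

(** The intersection is trivial, so the ranks add up: rank E + (d - rank E) = d. *)
Lemma add_kermx_tr {R : realType} (d : nat) (E : 'M[R]_d) :
  (1%:M <= E + kermx E^T)%MS.
Proof.
rewrite sub1mx /row_full mxrank_disjoint_sum ?cap_kermx_tr//.
by rewrite mxrank_ker mxrank_tr subnKC ?rank_leq_row.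
Qed.

(* Because the complement of an eigenspace of a symmetric H is H-invariant. *)
Lemma eigenproj_mul {R : realType} (d : nat) (H : 'M[R]_d) (l : R) :
  H^T = H -> eigenproj H l *m H = l *: eigenproj H l.
Proof.
move=> Hs; rewrite /eigenproj Hs; set E := eigenspace H l; set K := kermx E^T.
have EH : E *m H = l *: E by apply/eigenspaceP.
(* By symmetry K H E^T = K (E H)^T = l K E^T = 0. *)
have KH : (K *m H <= K)%MS.
  apply/sub_kermxP.
  by rewrite -mulmxA -{1}Hs -trmx_mul EH linearZ/= -scalemxAr mulmx_ker scaler0.
have PE := proj_mx_sub E K 1%:M; rewrite mul1mx in PE.
have PK := proj_mx_sub K E 1%:M; rewrite mul1mx in PK.
apply: trmx_inj; rewrite trmx_mul linearZ/= trmxK Hs.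
have cap := cap_kermx_tr _ E.
(* Rows of the identity are split along E and K before H acts. The E part is scaled by l and then
   fixed by the projection; the K part stays in K by [KH] and is annihilated. *)
rewrite -{1}[H]mul1mx -(add_proj_mx cap (add_kermx_tr _ E)) !mul1mx -/K.
rewrite mulmxDl (eigenspaceP PE) mulmxDl -scalemxAl proj_mx_proj//.
rewrite (proj_mx_0 cap) ?addr0//.
by apply: submx_trans KH; exact: submxMr.
Qed.

(** * Effect of a gradient step on the Lyapunov family *)

Lemma enormZ {R : realType} (d : nat) (c : R) (x : 'cV[R]_d) :
  enorm (c *: x) = `|c| * enorm x.
Proof.
rewrite /enorm -sqrtr_sqr -sqrtrM ?sqr_ge0// mulr_sumr.
by congr Num.sqrt; apply: eq_bigr => i _; rewrite mxE exprMn.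
Qed.

Lemma eigenproj_gradient_step {R : realType} (d : nat) (H : 'M[R]_d)
    (q x : 'cV[R]_d) (l u : R) : H^T = H ->
  eigenproj H l *m gradient (quadratic H q) (gradient_step H q u x) =
  (1 - l / u) *: (eigenproj H l *m gradient (quadratic H q) x).
Proof.
move=> Hs; rewrite /gradient_step !gradient_quadratic//.
set g := H *m x - q.
have -> : H *m (x - u^-1 *: g) - q = g - u^-1 *: (H *m g).
  by rewrite mulmxBr -scalemxAr /g addrAC.
rewrite mulmxBr -scalemxAr mulmxA eigenproj_mul// -scalemxAl scalerA.
by rewrite scalerBl scale1r mulrC.
Qed.

Lemma lyapunov_gradient_step {R : realType} (d : nat) (H : 'M[R]_d)
    (q x : 'cV[R]_d) (a b p u : R) : H^T = H -> 0 < u -> a <= u <= b ->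
  lyapunov H q a b p (gradient_step H q u x) =
  step_factor a b p u ^+ 2 * lyapunov H q a b p x.
Proof.
move=> Hs u0 /andP[au ub].
rewrite /lyapunov (eigenproj_gradient_step _ _ _ _ a u Hs).
rewrite (eigenproj_gradient_step _ _ _ _ b u Hs) !enormZ.
set ea := enorm _; set eb := enorm (eigenproj H b *m _).
have ea0 : 0 <= ea by exact: sqrtr_ge0.
have eb0 : 0 <= eb by exact: sqrtr_ge0.
move: ea eb ea0 eb0 => ea eb ea0 eb0.
have un0 : u != 0 by rewrite gt_eqF.
(* Since a <= u <= b, 1 - a / u is nonnegative and 1 - b / u nonpositive, so the absolute values are
   exactly the two bases of R_p. *)
have -> : `|1 - a / u| = (u - a) / u.
  rewrite ger0_norm ?subr_ge0 ?ler_pdivrMr ?mul1r//.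
  by rewrite mulrBl divff.
have -> : `|1 - b / u| = (b - u) / u.
  rewrite ler0_norm ?subr_le0 ?ler_pdivlMr ?mul1r//.
  by rewrite mulrBl divff// opprB.
have eu : 0 <= (u - a) / u by rewrite divr_ge0 ?subr_ge0// ltW.
have ev : 0 <= (b - u) / u by rewrite divr_ge0 ?subr_ge0// ltW.
rewrite /step_factor; move: eu ev.
move: ((u - a) / u) ((b - u) / u) => s t s0 t0.
rewrite !powRM// exprMn.
(* The integer square becomes a real power so that the exponents multiply to 2 p and 2 (1 - p). *)
rewrite -!(@powR_mulrn _ (_ `^ _) 2) ?powR_ge0// -!powRrM !(mulrC 2).
by rewrite mulrACA.
Qed.

Lemma fbarE {R : realType} (d : nat) (H : 'M[R]_d) (q : 'cV[R]_d) (a b : R) :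
  a + b != 0 -> fbar H q a b = lyapunov H q a b (b / (a + b)).
Proof.
move=> s0; apply/funext => x; rewrite /fbar /lyapunov.
have -> : 1 - b / (a + b) = a / (a + b) by field.
by rewrite !mulrA.
Qed.

Theorem proposition4p1 (R : realType) (a b : R) (ha : 0 < a) (hab : a < b) :
  let pstar := b / (a + b) in
  [/\ (forall p, 0 < p < 1 ->
         is_max (step_factors a b p) (worst_factor a b p) /\
         worst_factor a b p =
           (b - a) * (p `^ p * (1 - p) `^ (1 - p) / (b `^ p * a `^ (1 - p)))),
      1 - pstar = a / (a + b),
      unique (minimax_exponent a b) pstar,
      is_min [set worst_factor a b p | p in [set p | 0 < p < 1]]
        ((b - a) / (b + a)) &
      forall (d : nat) (H : 'M[R]_d) (q x0 : 'cV[R]_d),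
        H \is symmetricmx -> posdefmx H ->
        is_min (active_spectrum H (gradient (quadratic H q) x0)) a ->
        is_max (active_spectrum H (gradient (quadratic H q) x0)) b ->
        [/\ (forall p u x, 0 < p < 1 -> a <= u <= b ->
               lyapunov H q a b p (gradient_step H q u x) =
               step_factor a b p u ^+ 2 * lyapunov H q a b p x),
            fbar H q a b = lyapunov H q a b pstar &
            unique (minimax_member H q a b) (fbar H q a b)]].
Proof.
have a0b : 0 < a < b by rewrite ha.
have b0 : 0 < b := lt_trans ha hab.
have s0 : a + b != 0 by rewrite gt_eqF ?addr_gt0.
move=> pstar; split.
- move=> p p01; rewrite worst_factorE//; split=> //.
  exact: is_max_step_factors.
- by rewrite /pstar; field.
- exact: unique_minimax_exponent.
- split; first by exists pstar; [exact: pstar_bounds|exact: worst_factor_pstar].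
  by move=> _ [p p01 <-]; exact: worst_factor_ge.
- move=> d H q x0 /symmetricmx_tr Hs _ _ _.
  have fE := fbarE d H q a b s0.
  split=> //.
  + move=> p u x _ uab; apply: lyapunov_gradient_step => //.
    by case/andP: uab => au _; exact: lt_le_trans au.
  + have [minp uniqp] := unique_minimax_exponent _ _ a0b.
    split; first by exists pstar.
    (* Any minimax member comes with a minimax exponent; uniqueness of that exponent determines the
       function. *)
    by move=> V [p [/uniqp <- ->]].
Qed.
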